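(* Let $U_7^{20}=\{L(C)\in TLeib_7 : c_{2,3}=c_{1,2}=c_{1,1}=c_{0,1}=0,\ c_{0,0}\neq 0,\ c_{1,4}\neq 0\}$. 1. Two algebras $L(C)$ and $L(C')$ from $U_7^{20}$ are isomorphic if and only if $\frac{c'_{0,0}{c'}_{1,3}^{7}}{{c'}_{1,4}^{6}}=\frac{c_{0,0}c_{1,3}^7}{c_{1,4}^6}$. 2. For any $\lambda\in\mathbb{C}$ there exists $L(C)\in U_7^{20}$ with $\frac{c_{0,0}c_{1,3}^7}{c_{1,4}^6}=\lambda$. Moreover, the orbits (isomorphism classes) in $U_7^{20}$ are parameterized by the algebras $L(1,0,0,0,\lambda,1,0)$, $\lambda\in\mathbb{C}$: these algebras lie in $U_7^{20}$ and every algebra in $U_7^{20}$ is isomorphic to one of them.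
   Context: All algebras are over $\mathbb{C}$. For $C=(c_{0,0},c_{0,1},c_{1,1},c_{1,2},c_{1,3},c_{1,4},c_{2,3})\in\mathbb{C}^7$, $L(C)$ denotes the $7$-dimensional complex (Leibniz) algebra with basis $e_0,e_1,\dots,e_6$ and products (products of basis vectors not listed are zero): $[e_i,e_0]=e_{i+1}$ for $1\le i\le 5$; $[e_0,e_i]=-e_{i+1}$ for $2\le i\le 5$; $[e_0,e_0]=c_{0,0}e_6$; $[e_0,e_1]=-e_2+c_{0,1}e_6$; $[e_1,e_1]=c_{1,1}e_6$; $[e_1,e_2]=-[e_2,e_1]=c_{1,2}e_4+c_{1,3}e_5+c_{1,4}e_6$; $[e_1,e_3]=-[e_3,e_1]=c_{1,2}e_5+c_{1,3}e_6$; $[e_1,e_4]=-[e_4,e_1]=(c_{1,2}-c_{2,3})e_6$; $[e_2,e_3]=-[e_3,e_2]=c_{2,3}e_6$. $TLeib_7$ is the set of all $L(C)$, $C\in\mathbb{C}^7$. The entries of $C'$ are denoted $c'_{i,j}$, in the same order. ''Isomorphic'' means isomorphic as algebras over $\mathbb{C}$; an orbit is an isomorphism class. *)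

(* Defs.v *)
From HB Require Import structures.
From mathcomp Require Import all_boot all_order all_algebra.
From mathcomp Require Import reals.
From mathcomp Require Export complex.
From Stdlib Require Import Eqdep.

Set Implicit Arguments.
Unset Strict Implicit.
Unset Printing Implicit Defensive.
Import GRing.Theory.
Local Open Scope ring_scope.

(* No associativity, unit or identity is imposed on the product. *)
Record algebra (K : fieldType) := Algebra {
  alg_sort :> lmodType K;
  alg_mul : {bilinear alg_sort -> alg_sort -> alg_sort}
}.

Definition isomorphic (K : fieldType) (A B : algebra K) : Prop :=
  exists f : {linear A -> B},
    bijective f /\
    forall x y : A, f (alg_mul A x y) = alg_mul B (f x) (f y).

Record params (K : Type) := Params {
  c00 : K; c01 : K; c11 : K; c12 : K; c13 : K; c14 : K; c23 : K
}.

Section FamilyL.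
Variable K : fieldType.

Definition e (i : nat) : 'rV[K]_7 := delta_mx 0 (inord i).

(* [basis_mul C i j] is the product [e_i, e_j], for i, j <= 6. *)
Definition basis_mul (C : params K) (i j : nat) : 'rV[K]_7 :=
  match i, j with
  | 0, 0 => c00 C *: e 6
  | 0, 1 => - e 2 + c01 C *: e 6
  | 0, (2 | 3 | 4 | 5) => - e j.+1
  | (1 | 2 | 3 | 4 | 5), 0 => e i.+1
  | 1, 1 => c11 C *: e 6
  | 1, 2 => c12 C *: e 4 + c13 C *: e 5 + c14 C *: e 6
  | 2, 1 => - (c12 C *: e 4 + c13 C *: e 5 + c14 C *: e 6)
  | 1, 3 => c12 C *: e 5 + c13 C *: e 6
  | 3, 1 => - (c12 C *: e 5 + c13 C *: e 6)
  | 1, 4 => (c12 C - c23 C) *: e 6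
  | 4, 1 => - ((c12 C - c23 C) *: e 6)
  | 2, 3 => c23 C *: e 6
  | 3, 2 => - (c23 C *: e 6)
  | _, _ => 0
  end.

Definition L_mul (C : params K) (x y : 'rV[K]_7) : 'rV[K]_7 :=
  \sum_(i < 7) \sum_(j < 7) (x 0 i * y 0 j) *: basis_mul C i j.

Lemma L_mul_bilinear (C : params K) : bilinear_for *:%R *:%R (L_mul C).
Proof.
split=> u a x y; rewrite /L_mul /= scaler_sumr -big_split /=;
  apply: eq_bigr => i _; rewrite scaler_sumr -big_split /=;
  apply: eq_bigr => j _; rewrite !mxE scalerA -scalerDl; congr (_ *: _).
- by rewrite mulrDl mulrA.
- by rewrite mulrDr mulrCA.
Qed.

HB.instance Definition _ (C : params K) :=
  bilinear_isBilinear.Build K 'rV[K]_7 'rV[K]_7 'rV[K]_7 *:%R *:%R (L_mul C)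
    (L_mul_bilinear C).

Definition L (C : params K) : algebra K := @Algebra K 'rV[K]_7 (L_mul C).

Lemma L_mul_e (C : params K) (i j : nat) : (i < 7)%N -> (j < 7)%N ->
  alg_mul (L C) (e i) (e j) = basis_mul C i j.
Proof.
move=> ltin ltjn; rewrite /= /L_mul (bigD1 (inord i)) //= (bigD1 (inord j)) //=.
rewrite /e !mxE !eqxx /= mulr1 scale1r !inordK // !big1 ?addr0 // => k.
  by move=> ne_ki; apply: big1 => l _; rewrite !mxE (negPf ne_ki) mul0r scale0r.
by move=> ne_kj; rewrite !mxE (negPf ne_kj) andbF mulr0 scale0r.
Qed.

(* Hence the existential in [U20 (L C)] can only be witnessed by C itself. *)
Lemma L_inj : injective L.
Proof.
move=> C C' eqL.
have eq_mul i j : (i < 7)%N -> (j < 7)%N -> basis_mul C i j = basis_mul C' i j.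
  move=> lti ltj; rewrite -!L_mul_e //.
  have eqS : existT (fun V : lmodType K => {bilinear V -> V -> V}) _
               (alg_mul (L C)) = existT _ _ (alg_mul (L C')).
    exact: (congr1 (fun A : algebra K => existT
      (fun V : lmodType K => {bilinear V -> V -> V}) _ (alg_mul A)) eqL).
  by rewrite (inj_pair2 _ _ _ _ _ eqS).
have at_k i j k : (i < 7)%N -> (j < 7)%N ->
    basis_mul C i j 0 (inord k) = basis_mul C' i j 0 (inord k).
  by move=> lti ltj; rewrite eq_mul.
move: (at_k 0 0 6)%N (at_k 0 1 6)%N (at_k 1 1 6)%N (at_k 1 2 4)%N
  (at_k 1 2 5)%N (at_k 1 2 6)%N (at_k 2 3 6)%N.
case: C C' {eqL eq_mul at_k} => [? ? ? ? ? ? ?] [? ? ? ? ? ? ?] /=.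
rewrite !mxE -!val_eqE /= !inordK //= !(mulr1, mulr0, addr0, add0r, oppr0).
by do 7!move/(_ isT isT)->.
Qed.

Definition U20 (A : algebra K) : Prop :=
  exists C : params K,
    [/\ A = L C,
        [/\ c23 C = 0, c12 C = 0, c11 C = 0 & c01 C = 0],
        c00 C != 0
      & c14 C != 0].

End FamilyL.

(* Main.v *)
Require Import Defs.
From HB Require Import structures.
From mathcomp Require Import all_boot all_order all_algebra.
From mathcomp Require Import reals complex.
From mathcomp Require Import ring.

Set Implicit Arguments.
Unset Strict Implicit.
Unset Printing Implicit Defensive.
Import GRing.Theory.
Local Open Scope ring_scope.

(** Write (a, b, c) for the three free parameters c00, c13, c14 of an algebra
    in U20.  Its product is antisymmetric except for [e0, e0] = a e6, and
    [e_i, e0] = e_(i+1), so the algebra is generated by e0 and e1.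

    Suppose f is an isomorphism onto the algebra with parameters (a', b', c'),
    and let s be the e0-coordinate of f(e0) and t the e1-coordinate of f(e1).
    Since [x, x] = a x_0^2 e6, the vanishing of [e1, e1] keeps e0 out of f(e1),
    and injectivity on e6 forces s <> 0.  Then f is triangular on e1, ..., e6:
    bracketing repeatedly with f(e0) gives f(e_i) = t s^(i-1) e_i + higher
    terms.  Comparing the images of [e0, e0] and [e1, e2] yields
    [isomorphic_scaling]: for some nonzero s and t,
      a' = a t s^3,    b' t = b s^3,    c' t = c s^4.
    The off-diagonal part of f changes both sides of f([e1, e2]) =
    [f(e1), f(e2)] by the same amount, which is why only s and t survive.  Conversely,
    these relations make the diagonal map e0 |-> s e0, e_i |-> t s^(i-1) e_i an
    isomorphism ([scaling_isomorphic]).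

    It remains to describe the orbits of this two-dimensional torus on triples
    with a and c nonzero.  The monomial a b^7 / c^6 is invariant.  Eliminating t
    from the third relation leaves s^7 = a' c' / (a c) and b' c s = b c'.  When
    b <> 0 the second equation determines s, and the first is then the
    equality of the invariants; when b = b' = 0 any seventh root will do.  Hence
    the invariant is complete over a field with seventh roots
    ([isomorphic_params20P]).  The same roots show that every value lambda is
    attained, by the normal form (1, lambda^(1/7), 1). *)

Section Family.
Variable K : fieldType.
Implicit Types (a b c s t : K) (x y : 'rV[K]_7).

Definition params20 a b c : params K := Params a 0 0 0 b c 0.

(** [U20] only provides some parameters of the algebra; injectivity of [L]
    identifies them with C. *)
Lemma U20_params (C : params K) : U20 (L C) ->
  [/\ C = params20 (c00 C) (c13 C) (c14 C), c00 C != 0 & c14 C != 0].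
Proof.
case=> D [/(@L_inj K)-> [E23 E12 E11 E01] nz00 nz14]; split=> //.
by case: D E23 E12 E11 E01 {nz00 nz14} => ? ? ? ? ? ? ? /= -> -> -> ->.
Qed.

Lemma U20_params20 a b c : a != 0 -> c != 0 -> U20 (L (params20 a b c)).
Proof. by move=> nza nzc; exists (params20 a b c). Qed.

(** Indexing by natural numbers lets the coordinate of a product be computed by
    matching on the index. *)
Definition coord x k : K := x 0 (inord k).

Lemma coord_inj x y : (forall k, (k < 7)%N -> coord x k = coord y k) -> x = y.
Proof.
move=> eqxy; apply/rowP=> i; rewrite -(inord_val i).
exact: eqxy (ltn_ord i).
Qed.

Lemma coordD x y k : coord (x + y) k = coord x k + coord y k.
Proof. by rewrite /coord mxE. Qed.

Lemma coordZ a x k : coord (a *: x) k = a * coord x k.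
Proof. by rewrite /coord mxE. Qed.

Lemma coordN x k : coord (- x) k = - coord x k.
Proof. by rewrite /coord mxE. Qed.

Lemma coord0 k : coord 0 k = 0.
Proof. by rewrite /coord mxE. Qed.

Lemma coord_e i k : (i < 7)%N -> (k < 7)%N -> coord (e K i) k = (k == i)%:R.
Proof.
by move=> lti ltk; rewrite /coord /e mxE eqxx -val_eqE /= !inordK.
Qed.

(** The structure constants in coordinates: multiplicativity of a map becomes a
    list of polynomial identities, one per coordinate. *)
Definition coord20_mul a b c (g h : nat -> K) (k : nat) : K :=
  match k with
  | 2 | 3 | 4 => g k.-1 * h 0%N - g 0%N * h k.-1
  | 5 => g 4%N * h 0%N - g 0%N * h 4%N + b * (g 1%N * h 2%N - g 2%N * h 1%N)
  | 6 => g 5%N * h 0%N - g 0%N * h 5%N + b * (g 1%N * h 3%N - g 3%N * h 1%N)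
         + c * (g 1%N * h 2%N - g 2%N * h 1%N) + a * (g 0%N * h 0%N)
  | _ => 0
  end.

Lemma coord_mul a b c x y k : (k < 7)%N ->
  coord (alg_mul (L (params20 a b c)) x y) k
  = coord20_mul a b c (coord x) (coord y) k.
Proof.
move=> ltk; rewrite /= /L_mul.
transitivity (\sum_(0 <= i < 7) \sum_(0 <= j < 7)
   coord x i * coord y j * coord (basis_mul (params20 a b c) i j) k).
  rewrite big_mkord /coord summxE; apply: eq_bigr => i _.
  rewrite big_mkord summxE; apply: eq_bigr => j _.
  by rewrite !mxE !inord_val.
rewrite unlock /= !(coordD, coordN, coordZ, coord0).
by case: k ltk => [|[|[|[|[|[|[|k]]]]]]] // _; rewrite !coord_e //=; ring.
Qed.

(** The image of e_(i+1) is the bracket of the images of e_i and e0, so f is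
    known once the coordinates of f(e0) and f(e1) are; the relations are read
    off the e6-coordinate of [e0, e0] and the e5- and e6-coordinates of
    [e1, e2]. *)
Lemma isomorphic_scaling a b c a' b' c' :
    a != 0 -> a' != 0 ->
    isomorphic (L (params20 a b c)) (L (params20 a' b' c')) ->
  exists s t : K, [/\ s != 0, t != 0
    & [/\ a' = a * t * s ^+ 3, b' * t = b * s ^+ 3 & c' * t = c * s ^+ 4]].
Proof.
move=> nza nza' [f [bij_f f_mul]].
have fD x y : f (x + y) = f x + f y by exact: linearD.
have fZ d x : f (d *: x) = d *: f x by exact: linearZ.
pose u i : nat -> K := coord (f (e K i)).
have coord_f i j k : (i < 7)%N -> (j < 7)%N -> (k < 7)%N ->
    coord (f (basis_mul (params20 a b c) i j)) k
    = coord20_mul a' b' c' (u i) (u j) k.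
  by move=> lti ltj ltk; rewrite -L_mul_e // f_mul coord_mul.
have u10 : u 1%N 0%N = 0.
  (* The square of f(e1) is a' (u 1 0)^2 e6, while that of e1 is zero. *)
  have := coord_f 1%N 1%N 6%N isT isT isT; rewrite /= fZ scale0r coord0 => E.
  have /eqP : a' * (u 1%N 0%N * u 1%N 0%N) = 0 by rewrite E; ring.
  by rewrite !mulf_eq0 (negPf nza') orbb => /eqP.
have u6 k : (k < 7)%N -> a * u 6%N k = coord20_mul a' b' c' (u 0%N) (u 0%N) k.
  by move=> ltk; rewrite -coord_f //= fZ coordZ.
pose s := u 0%N 0%N; pose t := u 1%N 1%N.
have nzs : s != 0.
  (* If s = 0 then f(e0) squares to zero, so f(a e6) = 0. *)
  apply/eqP => s0; have fe6 : f (e K 6) = 0.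
    apply: coord_inj => k ltk; apply: (mulfI nza); rewrite coord0 mulr0.
    rewrite [LHS]u6 //; move: s0; rewrite /s.
    by case: k ltk => [|[|[|[|[|[|[|k]]]]]]] // _ s0; rewrite /= ?s0; ring.
  have : coord (e K 6) 6 = 0.
    have fe6_f0 : f (e K 6) = f 0 by rewrite fe6 linear0.
    by rewrite (bij_inj bij_f fe6_f0) coord0.
  by rewrite coord_e // => /eqP; rewrite oner_eq0.
have uS i k : (0 < i < 6)%N -> (k < 7)%N ->
    u i.+1 k = coord20_mul a' b' c' (u i) (u 0%N) k.
  case: i => [|[|[|[|[|[|i]]]]]] // _ ltk; by rewrite -coord_f.
have [u20 u21 u22 u23] : [/\ u 2%N 0%N = 0, u 2%N 1%N = 0,
    u 2%N 2%N = t * s & u 2%N 3%N = u 1%N 2%N * s].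
  by split; rewrite uS //= ?u10 -/s -/t; ring.
have [u30 u31 u32] : [/\ u 3%N 0%N = 0, u 3%N 1%N = 0 & u 3%N 2%N = 0].
  by split; rewrite uS //= ?u20 ?u21; ring.
have [u33 u34] : u 3%N 3%N = t * s ^+ 2 /\ u 3%N 4%N = u 1%N 2%N * s ^+ 2.
  by split; rewrite uS //= u20 ?u22 ?u23 -/s; ring.
have [u40 u41 u42 u43] :
    [/\ u 4%N 0%N = 0, u 4%N 1%N = 0, u 4%N 2%N = 0 & u 4%N 3%N = 0].
  by split; rewrite uS //= ?u30 ?u31 ?u32; ring.
have [u44 u45] : u 4%N 4%N = t * s ^+ 3 /\ u 4%N 5%N = u 1%N 2%N * s ^+ 3.
  by split; rewrite uS //= u30 ?u31 ?u32 ?u33 ?u34 -/s; ring.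
have [u50 u54] : u 5%N 0%N = 0 /\ u 5%N 4%N = 0.
  by split; rewrite uS //= ?u40 ?u43; ring.
have [u51 u52 u53] : [/\ u 5%N 1%N = 0, u 5%N 2%N = 0 & u 5%N 3%N = 0].
  by split; rewrite uS //= ?u40 ?u41 ?u42; ring.
have [u55 u56] : u 5%N 5%N = t * s ^+ 4 /\ u 5%N 6%N = u 1%N 2%N * s ^+ 4.
  by split; rewrite uS //= u40 ?u41 ?u42 ?u43 ?u44 ?u45 -/s; ring.
have u65 : u 6%N 5%N = 0 by rewrite uS //= u50 u51 u52 u54; ring.
have u66 : u 6%N 6%N = t * s ^+ 5.
  by rewrite uS //= u50 u51 u52 u53 u55 -/s; ring.
have a's2 : a' * s ^+ 2 = a * t * s ^+ 5.
  by rewrite -mulrA -u66 u6 //=; rewrite -/s; ring.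
have nzt : t != 0.
  apply: contraNneq nza' => t0; move/eqP: a's2.
  by rewrite t0 mulr0 mul0r mulf_eq0 expf_eq0 (negPf nzs) orbF.
have u12_e k : (k < 7)%N -> b * u 5%N k + c * u 6%N k
    = coord20_mul a' b' c' (u 1%N) (u 2%N) k.
  move=> ltk; rewrite -coord_f //=.
  by rewrite !fD !fZ !coordD !coordZ mul0r add0r.
have b'ts : b' * t * (t * s) = b * s ^+ 3 * (t * s).
  have := u12_e 5%N isT; rewrite /= u10 u20 u21 u22 u55 u65 -/t => E.
  by transitivity (b * (t * s ^+ 4) + c * 0); [rewrite E|]; ring.
have b'_eq : b' * t = b * s ^+ 3 by apply: mulIf b'ts; rewrite mulf_neq0.
exists s, t; split=> //; split=> //.
  by apply: (mulIf (expf_neq0 2 nzs)); rewrite a's2; ring.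
apply: (mulIf (mulf_neq0 nzt nzs)).
have := u12_e 6%N isT; rewrite /= u10 u20 u21 u22 u23 u56 u66 -/t => E.
(* The e2-coordinate u12 of f(e1) contributes b u12 s^4 on the side of
   f([e1, e2]) and b' t u12 s on the side of the bracket of the images; these
   agree because b' t = b s^3. *)
apply: (addrI (b * (u 1%N 2%N * s ^+ 4))).
transitivity (b * (u 1%N 2%N * s ^+ 4) + c * (t * s ^+ 5)); last by ring.
by rewrite E; ring: b'_eq.
Qed.

(** Giving e0 weight s and e_i weight t s^(i-1) respects [e_i, e0] = e_(i+1)
    for any s and t; the three relations are the compatibility of the weights
    with [e0, e0], [e1, e2] and [e1, e3]. *)
Lemma scaling_isomorphic a b c a' b' c' s t :
    s != 0 -> t != 0 ->
    a' = a * t * s ^+ 3 -> b' * t = b * s ^+ 3 -> c' * t = c * s ^+ 4 ->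
  isomorphic (L (params20 a b c)) (L (params20 a' b' c')).
Proof.
move=> nzs nzt a'E b'E c'E.
have b'V : b' = b * s ^+ 3 / t by rewrite -b'E mulfK.
have c'V : c' = c * s ^+ 4 / t by rewrite -c'E mulfK.
pose w i := if i is j.+1 then t * s ^+ j else s.
have nzw i : w i != 0.
  by case: i => [|i] //=; rewrite mulf_neq0 ?expf_neq0.
pose f := mulmxr (diag_mx (\row_(i < 7) w i)) : {linear 'rV[K]_7 -> 'rV[K]_7}.
pose g := mulmxr (diag_mx (\row_(i < 7) (w i)^-1)) : 'rV[K]_7 -> 'rV[K]_7.
have coord_f x k : (k < 7)%N -> coord (f x) k = coord x k * w k.
  by move=> ltk; rewrite /coord /= mul_mx_diag !mxE inordK.
have coord_g x k : (k < 7)%N -> coord (g x) k = coord x k / w k.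
  by move=> ltk; rewrite /coord /g /= mul_mx_diag !mxE inordK.
exists f; split.
  exists g => x; apply: coord_inj => k ltk; rewrite ?(coord_f, coord_g) //.
    by rewrite mulfK.
  by rewrite mulfVK.
move=> x y; apply: coord_inj => k ltk.
rewrite coord_f // !coord_mul //.
case: k ltk => [|[|[|[|[|[|[|k]]]]]]] // _; rewrite /= ?coord_f //=.
- by ring.
- by ring.
- by ring.
- by ring.
- by ring.
- by rewrite b'V; field.
- by rewrite b'V c'V a'E; field.
Qed.

End Family.

(** The torus orbits are separated by a b^7 / c^6 because, after t is
    eliminated, the remaining freedom in s is fixed by the ratio of b and b' when b is nonzero,
    and b imposes no condition when it vanishes. *)
Lemma isomorphic_params20P (K : fieldType) (a b c a' b' c' : K) :
  (forall x : K, exists s, s ^+ 7 = x) ->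
  a != 0 -> c != 0 -> a' != 0 -> c' != 0 ->
  isomorphic (L (params20 a b c)) (L (params20 a' b' c'))
  <-> a' * b' ^+ 7 / c' ^+ 6 = a * b ^+ 7 / c ^+ 6.
Proof.
move=> root7 nza nzc nza' nzc'; split.
  case/isomorphic_scaling=> // s [t [nzs nzt [a'E b'E c'E]]].
  have -> : b' = b * s ^+ 3 / t by rewrite -b'E mulfK.
  have -> : c' = c * s ^+ 4 / t by rewrite -c'E mulfK.
  by rewrite a'E; field; rewrite nzc nzs nzt.
move=> inv_eq.
(* Solving c' t = c s^4 for t turns the other two relations into these. *)
suff [s [nzs s7 bE]] : exists s, [/\ s != 0, s ^+ 7 = a' * c' / (a * c)
    & b' * (c * s) = b * c'].
  apply: (@scaling_isomorphic K a b c a' b' c' s (c * s ^+ 4 / c')) => //.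
  - by rewrite !mulf_neq0 ?expf_neq0 ?invr_eq0.
  - transitivity (a * c / c' * s ^+ 7); last by field.
    by rewrite s7; field; rewrite nza nzc.
  - transitivity (b' * (c * s) * s ^+ 3 / c'); first by field.
    by rewrite bE; field.
  - by field.
pose d := a * c' ^+ 6 / (a' * c ^+ 6).
have nzd : d != 0 by rewrite !mulf_neq0 ?invr_eq0 ?mulf_neq0 ?expf_neq0.
have b'7 : b' ^+ 7 = b ^+ 7 * d.
  transitivity (a' * b' ^+ 7 / c' ^+ 6 * (c' ^+ 6 / a')).
    by field; rewrite nza' nzc'.
  by rewrite inv_eq /d; field; rewrite nzc nza'.
have pow7_eq0 (x : K) : (x ^+ 7 == 0) = (x == 0) by rewrite expf_eq0.
have b_eq0 : (b' == 0) = (b == 0).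
  by rewrite -pow7_eq0 b'7 mulf_eq0 (negPf nzd) orbF pow7_eq0.
have [b0 | nzb] := eqVneq b 0.
  have b'0 : b' = 0 by apply/eqP; rewrite b_eq0 b0.
  have [s s7] := root7 (a' * c' / (a * c)).
  exists s; split=> //; last by rewrite b0 b'0 !mul0r.
  by rewrite -pow7_eq0 s7 !mulf_neq0 ?invr_eq0 ?mulf_neq0.
have nzb' : b' != 0 by rewrite b_eq0.
exists (b * c' / (b' * c)); split.
- by rewrite !mulf_neq0 ?invr_eq0 ?mulf_neq0.
- transitivity (b ^+ 7 * (c' / c) ^+ 7 / b' ^+ 7).
    by field; rewrite nzb' nzc.
  by rewrite b'7 /d; field; rewrite nza nza' nzb nzc nzc'.
- by field; rewrite nzb' nzc.
Qed.

Theorem proposition2p12 (R : realType) :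
  [/\ (forall C C' : params R[i], U20 (L C) -> U20 (L C') ->
         isomorphic (L C) (L C') <->
         c00 C' * c13 C' ^+ 7 / c14 C' ^+ 6 = c00 C * c13 C ^+ 7 / c14 C ^+ 6),
      (forall lambda : R[i], exists C : params R[i],
         U20 (L C) /\ c00 C * c13 C ^+ 7 / c14 C ^+ 6 = lambda),
      (forall lambda : R[i], U20 (L (Params 1 0 0 0 lambda 1 0)))
    & (forall A : algebra R[i], U20 A ->
         exists lambda : R[i], isomorphic A (L (Params 1 0 0 0 lambda 1 0)))].
Proof.
have root7 (x : R[i]) : exists s, s ^+ 7 = x.
  by eexists; apply: Num.Theory.rootCK.
have nz1 : 1 != 0 :> R[i] by exact: oner_neq0.
split.
- move=> C C' /U20_params[-> nza nzc] /U20_params[-> nza' nzc'].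
  exact: isomorphic_params20P.
- move=> lambda; have [s s7] := root7 lambda.
  exists (params20 1 s 1); split; first exact: U20_params20.
  by rewrite /= s7 expr1n divr1 mul1r.
- by move=> lambda; apply: U20_params20.
- move=> A [C [-> vanish nza nzc]].
  have UC : U20 (L C) by exists C.
  have [CE _ _] := U20_params UC; rewrite CE.
  have [s s7] := root7 (c00 C * c13 C ^+ 7 / c14 C ^+ 6).
  exists s; apply/(isomorphic_params20P _ s root7 nza nzc nz1 nz1).
  by rewrite s7 expr1n divr1 mul1r.
Qed.
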